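(* Let $G=(V,E)$ be any undirected, connected graph. Then the cosmological polytope $\mathcal{C}_G$ has a regular unimodular triangulation.
   Context: Graphs are finite and undirected, and need not be simple. For a graph $G=(V,E)$, let $x_i$ ($i\in V$) and $x_e$ ($e\in E$) denote the standard basis vectors of $\mathbb{R}^{|V|+|E|}$. The cosmological polytope of $G$ is $$\mathcal{C}_G=\mathrm{conv}\{x_i+x_j-x_e,\ x_i-x_j+x_e,\ -x_i+x_j+x_e ~:~ e=ij\in E\}.$$ It is a lattice polytope with respect to $\mathbb{Z}^{|V|+|E|}$, of dimension $|V|+|E|-1$. A triangulation of a lattice polytope into lattice simplices is unimodular if every maximal simplex has minimal volume (normalized volume $1$) with respect to the lattice $\mathbb{Z}^{|V|+|E|}\cap\mathrm{aff}(\mathcal{C}_G)$. *)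

(* Defs.v *)
(* World: MathComp, with classical sets and reals from MathComp-Analysis. *)
From HB Require Import structures.
From mathcomp Require Import all_boot all_order all_algebra finmap.
From mathcomp Require Import boolp classical_sets reals.

Set Implicit Arguments.
Unset Strict Implicit.
Unset Printing Implicit Defensive.

Import Order.TTheory GRing.Theory Num.Theory.
Local Open Scope classical_set_scope.
Local Open Scope ring_scope.

(* A finite multigraph is given by its finite types of vertices and edges and
   by [ends], which lists the two endpoints of each edge in an arbitrary order;
   every notion below is invariant under exchanging them.  Loops and parallel
   edges are allowed. *)
Definition adjacent (V E : finType) (ends : E -> V * V) : rel V :=
  fun u v => [exists e, (ends e == (u, v)) || (ends e == (v, u))].

Definition graph_connected (V E : finType) (ends : E -> V * V) : Prop :=
  (0 < #|V|)%N /\ forall u v : V, connect (adjacent ends) u v.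

Definition conv (R : realType) (n : nat) (A : set 'rV[R]_n) : set 'rV[R]_n :=
  [set x | exists (m : nat) (p : 'I_m -> 'rV[R]_n) (c : 'I_m -> R),
     [/\ forall i, A (p i), forall i, 0 <= c i,
         \sum_(i < m) c i = 1 & x = \sum_(i < m) c i *: p i]].

Definition aff (R : realType) (n : nat) (A : set 'rV[R]_n) : set 'rV[R]_n :=
  [set x | exists (m : nat) (p : 'I_m -> 'rV[R]_n) (c : 'I_m -> R),
     [/\ forall i, A (p i),
         \sum_(i < m) c i = 1 & x = \sum_(i < m) c i *: p i]].

Definition int_points (R : realType) (n : nat) : set 'rV[R]_n :=
  [set x | x \is a mxOver Num.int].
Arguments int_points : clear implicits.

Definition vec_v (R : realType) (V E : finType) (i : V) :
    'rV[R]_(#|V| + #|E|) := delta_mx 0 (lshift #|E| (enum_rank i)).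
Definition vec_e (R : realType) (V E : finType) (e : E) :
    'rV[R]_(#|V| + #|E|) := delta_mx 0 (rshift #|V| (enum_rank e)).

Definition cosmological_polytope (R : realType) (V E : finType)
    (ends : E -> V * V) : set 'rV[R]_(#|V| + #|E|) :=
  conv [set p | exists e : E,
    let xi := vec_v R E (ends e).1 in
    let xj := vec_v R E (ends e).2 in
    let xe := vec_e R V e in
    [\/ p = xi + xj - xe, p = xi - xj + xe | p = - xi + xj + xe]].
Arguments cosmological_polytope R {V E} ends.

(* A simplex is represented by its finite set of vertices. *)
Definition affinely_independent (R : realType) (n : nat)
    (s : {fset 'rV[R]_n}) : Prop :=
  forall c : 'rV[R]_n -> R,
    \sum_(v <- s) c v = 0 -> \sum_(v <- s) c v *: v = 0 ->
    forall v, v \in s -> c v = 0.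

(* [T] is the set of all nonempty faces of the triangulation, not only of its
   maximal simplices. *)
Record lattice_triangulation (R : realType) (n : nat) (P : set 'rV[R]_n)
    (T : {fset {fset 'rV[R]_n}}) : Prop := {
  tri_nonempty : forall s, s \in T -> s != fset0;
  tri_simplex : forall s, s \in T -> affinely_independent s;
  tri_lattice : forall s, s \in T -> forall v, v \in s -> int_points R n v;
  tri_face : forall s t, s \in T -> t != fset0 -> (t `<=` s)%fset -> t \in T;
  tri_inter : forall s t, s \in T -> t \in T ->
    conv [set` s] `&` conv [set` t] = conv [set` (s `&` t)%fset];
  tri_cover : P = \bigcup_(s in [set` T]) conv [set` s]
}.

Definition face_minimizing (R : realType) (n : nat) (Q : set 'rV[R]_n)
    (u : 'cV[R]_n) : set 'rV[R]_n :=
  [set y | Q y /\ forall z, Q z -> (y *m u) 0 0 <= (z *m u) 0 0].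

(* Lower faces are those minimizing a functional whose coefficient on the last
   (height) coordinate is positive. *)
Definition lower_face (R : realType) (n : nat) (Q F : set 'rV[R]_(n + 1)) :
    Prop :=
  F !=set0 /\
  exists u : 'cV[R]_(n + 1), 0 < u (rshift n 0) 0 /\ F = face_minimizing Q u.

Definition lifted_polytope (R : realType) (n : nat) (P : set 'rV[R]_n)
    (w : 'rV[R]_n -> R) : set 'rV[R]_(n + 1) :=
  conv [set row_mx p (w p)%:M | p in P `&` int_points R n].

(* The cells are exactly the projections of the lower faces of the polytope
   obtained by lifting the lattice points of [P] to the heights [w]. *)
Definition regular (R : realType) (n : nat) (P : set 'rV[R]_n)
    (T : {fset {fset 'rV[R]_n}}) : Prop :=
  exists w : 'rV[R]_n -> R,
    [set conv [set` s] | s in [set` T]] =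
    [set lsubmx @` F | F in lower_face (lifted_polytope P w)].

(* The rows of [B] form a Z-basis of the group of differences of points of the
   affine lattice [L]. *)
Definition affine_lattice_basis (R : realType) (n d : nat)
    (L : set 'rV[R]_n) (B : 'M[R]_(d, n)) : Prop :=
  row_free B /\
  [set x - y | x in L & y in L] =
  [set map_mx intr z *m B | z in [set: 'rV[int]_d]].

(* In coordinates with respect to a basis of a lattice of rank [d], the
   volume of the simplex with vertices v_0, ..., v_d is 1/d! times the absolute
   determinant of the edge vectors v_i - v_0; the normalized volume drops the
   factor 1/d!.  It does not depend on the choice of [B] or on the order [v] of
   the vertices. *)
Definition normalized_volume (R : realType) (n : nat) (L : set 'rV[R]_n)
    (s : {fset 'rV[R]_n}) (vol : R) : Prop :=
  exists (d : nat) (B : 'M[R]_(d, n)) (v : 'I_d.+1 -> 'rV[R]_n) (M : 'M[R]_d),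
    [/\ affine_lattice_basis L B,
        injective v /\ [set` s] = range v,
        \matrix_(i < d) (v (lift ord0 i) - v ord0) = M *m B
      & vol = `|\det M|].

Definition unimodular (R : realType) (n : nat) (P : set 'rV[R]_n)
    (T : {fset {fset 'rV[R]_n}}) : Prop :=
  forall s, s \in T -> (forall t, t \in T -> ~~ (s `<` t)%fset) ->
    normalized_volume (int_points R n `&` aff P) s 1.

(* Main.v *)
Require Import Defs.
From HB Require Import structures.
From mathcomp Require Import all_boot all_order all_algebra finmap.
From mathcomp Require Import boolp classical_sets reals.
From mathcomp Require Import ring lra.

Set Implicit Arguments.
Unset Strict Implicit.
Unset Printing Implicit Defensive.

Import Order.TTheory GRing.Theory Num.Theory.
Local Open Scope classical_set_scope.
Local Open Scope ring_scope.

(** The triangulation comes from heights on a finite set A of lattice points of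
    the polytope: the vectors x_v and x_e and the three generators of every
    edge.  All of A lies in the hyperplane where the coordinates sum to
    1, so affine functions on the polytope are linear ones, and affine
    independence of points of A is linear independence.

    Given weights w on A, consider the polyhedron of the linear functionals u
    that are at most w on A.  The cells are the nonempty sets of points of A where such a
    functional attains its bound ([tight], [cells]).  Two cells meet in a common
    face by complementary slackness ([inter_cells]).  A point x of the polytope
    is covered because the value at x is maximal at some vertex u of the
    polyhedron, and x is then in the hull of the tight set of u
    ([cover_cells]).  A vertex is reached from any u by moving along directions
    that vanish on the tight set and do not decrease the value at x ([pivot]).
    Weights avoiding the relations between dependent points make all cells
    simplices ([generic_weight]).  The functional (-u, 1) shows each cell as the
    projection of a lower face ([cells_regular]).

    For unimodularity, the weights are a small generic perturbation of 0 on the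
    standard basis vectors and 1 on the points with a negative coordinate.
    For an edge e = ij put
      t = x_i + x_j - x_e,  y = x_i - x_j + x_e,  y' = - x_i + x_j + x_e.
    The relations
      t + x_e = x_i + x_j,  t + y = 2 x_i,  t + y' = 2 x_j,  y + y' = 2 x_e
    have a larger weight on the left, so the two points on the left are never
    both tight ([not_both_tight]), except that y = y' = x_e when e is a loop.
    A maximal cell s spans the whole space.  If the integer span N of s missed
    some x_v0, the function h on vertices with value 1 at the v such that
    x_v - x_v0 is in N and 0 elsewhere would extend edge by edge to a linear
    functional vanishing on s: the exclusions leave at most one constraint on
    the value at x_e, apart from the pairs of x_e with y or y', for which
    x_i - x_j is in N and hence h(i) = h(j).  This contradicts spanning, so N
    contains all x_v ([intspan_xv]), then all x_e ([intspan_xe]).  A simplex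
    whose vertices generate the integer lattice is unimodular
    ([unimodular_simplex]). *)

(** * Linear functionals, convex hulls and independence *)

Section Pairing.
Variables (R : realType) (n : nat).
Implicit Types (x y : 'rV[R]_n) (u v : 'cV[R]_n) (s t : {fset 'rV[R]_n}).

Definition ev x u : R := (x *m u) 0 0.

Lemma evDl x y u : ev (x + y) u = ev x u + ev y u.
Proof. by rewrite /ev mulmxDl mxE. Qed.
Lemma evBl x y u : ev (x - y) u = ev x u - ev y u.
Proof. by rewrite /ev mulmxBl !mxE. Qed.
Lemma evNl x u : ev (- x) u = - ev x u.
Proof. by rewrite /ev mulNmx !mxE. Qed.
Lemma evDr x u v : ev x (u + v) = ev x u + ev x v.
Proof. by rewrite /ev mulmxDr mxE. Qed.
Lemma evBr x u v : ev x (u - v) = ev x u - ev x v.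
Proof. by rewrite /ev mulmxBr !mxE. Qed.
Lemma evNr x u : ev x (- u) = - ev x u.
Proof. by rewrite /ev mulmxN !mxE. Qed.
Lemma evZr k x u : ev x (k *: u) = k * ev x u.
Proof. by rewrite /ev -scalemxAr mxE. Qed.
Lemma ev0l u : ev 0 u = 0.
Proof. by rewrite /ev mul0mx mxE. Qed.
Lemma ev0r x : ev x 0 = 0.
Proof. by rewrite /ev mulmx0 mxE. Qed.

Lemma ev_sum (I : Type) (r : seq I) (Q : pred I) (c : I -> R)
    (p : I -> 'rV[R]_n) u :
  ev (\sum_(i <- r | Q i) c i *: p i) u = \sum_(i <- r | Q i) c i * ev (p i) u.
Proof.
rewrite /ev mulmx_suml summxE; apply: eq_bigr => i _.
by rewrite -scalemxAl mxE.
Qed.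

Lemma sum_nth (U : zmodType) (T : choiceType) (z : T) (s : {fset T})
    (F : T -> U) :
  \sum_(i < size s) F (nth z s i) = \sum_(a <- s) F a.
Proof. by rewrite (big_nth z) big_mkord. Qed.

Lemma sum_fibers (U : lmodType R) (T : choiceType) (m : nat) (s : {fset T})
    (p : 'I_m -> T) (c : 'I_m -> R) (F : T -> U) :
  (forall i, p i \in s) ->
  \sum_(a <- s) (\sum_(i | p i == a) c i) *: F a = \sum_i c i *: F (p i).
Proof.
move=> ps; under eq_bigr => a _ do rewrite scaler_suml big_mkcond /=.
rewrite exchange_big /=; apply: eq_bigr => i _.
rewrite (bigD1_seq (p i)) ?ps ?fset_uniq //= eqxx big1_seq ?addr0 // => a /andP[ai _].
by rewrite eq_sym (negbTE ai).
Qed.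

(** For finite point sets, points of the convex hull are combinations with one
    coefficient per point, whereas the definition allows repeated points. *)
Lemma conv_fsetP s x : conv [set` s] x <-> exists c : 'rV[R]_n -> R,
  [/\ forall a, a \in s -> 0 <= c a, \sum_(a <- s) c a = 1
    & x = \sum_(a <- s) c a *: a].
Proof.
split=> [[m [p [c [ps c0 c1 ->]]]]|[c [c0 c1 ->]]].
  exists (fun a => \sum_(i | p i == a) c i); split=> [a _||].
  - by apply: sumr_ge0 => i _; exact: c0.
  - have := sum_fibers c (fun=> 1 : R^o) ps.
    rewrite /GRing.scale /=; under eq_bigr => a _ do rewrite mulr1.
    by move=> ->; rewrite -[RHS]c1; apply: eq_bigr => i _; rewrite mulr1.
  - by rewrite (sum_fibers c id ps).
exists (size s), (fun i => nth 0 s i), (fun i => c (nth 0 s i)); split.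
- by move=> i; rewrite /= mem_nth.
- by move=> i; apply: c0; rewrite mem_nth.
- by rewrite sum_nth.
- by rewrite (sum_nth _ _ (fun a => c a *: a)).
Qed.

(** Choosing a combination for every point of s and composing coefficients
    shows that convex hulls of finite sets are convex. *)
Lemma conv_subset s t :
  (forall a, a \in s -> conv [set` t] a) -> conv [set` s] `<=` conv [set` t].
Proof.
move=> st x /conv_fsetP[c [c0 c1 ->]]; apply/conv_fsetP.
have /choice[e eP] : forall a, exists e : 'rV[R]_n -> R, a \in s ->
    [/\ forall b, b \in t -> 0 <= e b, \sum_(b <- t) e b = 1
      & a = \sum_(b <- t) e b *: b].
  move=> a; case: (boolP (a \in s)) => [/st/conv_fsetP[e ?]|_]; first by exists e.
  by exists (fun=> 0).
exists (fun b => \sum_(a <- s) c a * e a b); split=> [b bt||].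
- rewrite big_seq; apply: sumr_ge0 => a sa.
  by have [e0 _ _] := eP _ sa; rewrite mulr_ge0 ?c0 ?e0.
- rewrite exchange_big /= -[RHS]c1 big_seq [RHS]big_seq; apply: eq_bigr => a sa.
  by have [_ e1 _] := eP _ sa; rewrite -mulr_sumr e1 mulr1.
- under [RHS]eq_bigr => b _ do rewrite scaler_suml.
  rewrite exchange_big /= big_seq [RHS]big_seq; apply: eq_bigr => a sa.
  have [_ _ ea] := eP _ sa; transitivity (c a *: \sum_(b <- t) e a b *: b).
    by rewrite -ea.
  rewrite scaler_sumr.
  by apply: eq_bigr => b _; rewrite scalerA.
Qed.

Lemma conv_fset_mem s a : a \in s -> conv [set` s] a.
Proof.
move=> sa; exists 1%N, (fun=> a), (fun=> 1); split=> //.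
  by rewrite big_ord1.
by rewrite big_ord1 scale1r.
Qed.

(** This is spanning by duality: no nonzero functional vanishes on s. *)
Definition spanning s := forall d : 'cV[R]_n, (forall a, a \in s -> ev a d = 0) -> d = 0.

Definition independent s := forall c : 'rV[R]_n -> R,
  \sum_(a <- s) c a *: a = 0 -> forall a, a \in s -> c a = 0.

Definition rows s : 'M[R]_(size s, n) := \matrix_(i, j) (nth 0 s i) 0 j.

Lemma row_rows s i : row i (rows s) = nth 0 s i.
Proof. by apply/rowP => j; rewrite !mxE. Qed.

Lemma mul_rows s (c : 'rV[R]_(size s)) :
  c *m rows s = \sum_i c 0 i *: nth 0 s i.
Proof. by rewrite mulmx_sum_row; apply: eq_bigr => i _; rewrite row_rows. Qed.

Lemma rows_mul s m (M : 'M[R]_(n, m)) i j :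
  (rows s *m M) i j = ev (nth 0 s i) (col j M).
Proof. by rewrite /ev -row_rows !mxE; apply: eq_bigr => k _; rewrite !mxE. Qed.

Lemma rV_fun s (c : 'rV[R]_(size s)) :
  exists f : 'rV[R]_n -> R, forall i : 'I_(size s), f (nth 0 s i) = c 0 i.
Proof.
exists (fun a => if insub (index a s) is Some i then c 0 i else 0) => i.
by rewrite index_uniq ?fset_uniq // valK.
Qed.

Lemma independent_row_free s : independent s -> row_free (rows s).
Proof.
move=> ind; rewrite -kermx_eq0; apply/rowV0P => c /sub_kermxP.
rewrite mul_rows => c0; have [f fP] := rV_fun c.
apply/rowP => i; rewrite mxE -fP; apply: ind; last by rewrite mem_nth.
rewrite -(sum_nth 0 s (fun a => f a *: a)) -[RHS]c0.
by apply: eq_bigr => j _; rewrite fP.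
Qed.

(** A matrix with independent rows has a right inverse, so functionals take
    arbitrary prescribed values on an independent set. *)
Lemma independent_prescribe s (f : 'rV[R]_n -> R) :
  independent s -> exists d, forall a, a \in s -> ev a d = f a.
Proof.
move=> /independent_row_free/row_freeP[B B1].
exists (col 0 (B *m \col_i f (nth 0 s i))) => a sa.
have ia : (index a s < size s)%N by rewrite index_mem.
have {1}-> : a = nth 0 s (Ordinal ia) by rewrite /= nth_index.
by rewrite -rows_mul mulmxA B1 mul1mx mxE /= nth_index.
Qed.

(** If the rows had a nonzero cokernel, one of its columns would be a nonzero
    functional vanishing on s. *)
Lemma spanning_sum s x : spanning s -> exists c, x = \sum_(a <- s) c a *: a.
Proof.
move=> sp; have : row_full (rows s).
  rewrite -cokermx_eq0; apply/eqP/matrixP => i j; rewrite [RHS]mxE.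
  have /(_ (col j (cokermx (rows s)))) := sp.
  move=> /(_ _)/colP/(_ i); rewrite !mxE; apply=> a sa.
  have ia : (index a s < size s)%N by rewrite index_mem.
  have {1}-> : a = nth 0 s (Ordinal ia) by rewrite /= nth_index.
  by rewrite -rows_mul mulmx_coker mxE.
move=> /row_fullP[B B1]; have [f fP] := rV_fun (x *m B).
exists f; rewrite -(sum_nth 0 s (fun a => f a *: a)) -[LHS]mulmx1 -B1 mulmxA mul_rows.
by apply: eq_bigr => j _; rewrite fP.
Qed.

End Pairing.

(** * Tight sets of bounded functionals *)

Section FiniteExtrema.
Variables (R : realFieldType) (T : eqType).

Lemma seq_argmax (s : seq T) (Q : T -> Prop) (f : T -> R) :
  (exists2 x, x \in s & Q x) ->
  exists x, [/\ x \in s, Q x & forall y, y \in s -> Q y -> f y <= f x].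
Proof.
elim: s => [[]//|z s ih] [x xs Qx].
have [[y ys Qy]|noQ] := pselect (exists2 y, y \in s & Q y); last first.
  have noQs y : y \in s -> Q y -> False by move=> ys Qy; apply: noQ; exists y.
  exists x; split=> // y; rewrite inE => /orP[/eqP->|/noQs//] Qz.
  by move: xs; rewrite inE => /orP[/eqP->//|/noQs].
have [m [ms Qm mP]] := ih (ex_intro2 _ _ y ys Qy).
have [[Qz fz]|nz] := pselect (Q z /\ f m <= f z).
  exists z; split; rewrite ?mem_head // => v; rewrite inE => /orP[/eqP->//|vs] Qv.
  exact: le_trans (mP v vs Qv) fz.
exists m; split; rewrite ?inE ?ms ?orbT // => v; rewrite inE => /orP[/eqP->|/mP//] Qz.
by rewrite leNgt; apply/negP => /ltW fz; apply: nz.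
Qed.

Lemma small_scalar (s : seq T) (p q : T -> R) :
  (forall a, a \in s -> 0 < q a) ->
  exists2 t, 0 < t & forall a, a \in s -> t * p a < q a.
Proof.
elim: s => [_|z s ih q0]; first by exists 1.
have [|t t0 tP] := ih; first by move=> a sa; apply: q0; rewrite inE sa orbT.
have qz : 0 < q z by apply: q0; rewrite mem_head.
have pz : 0 < `|p z| + 1 by rewrite ltr_pwDr.
exists (Num.min t (q z / (`|p z| + 1))); first by rewrite lt_min t0 divr_gt0.
move=> a; rewrite inE => /orP[/eqP->|sa].
  apply: (@le_lt_trans _ _ (q z / (`|p z| + 1) * `|p z|)).
    apply: (le_trans (ler_norm _)); rewrite normrM ler_wpM2r //.
    by rewrite ger0_norm ?ge_min ?lexx ?orbT // le_min ltW // divr_ge0 ?ltW.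
  by rewrite -mulrA gtr_pMr // mulrC ltr_pdivrMr // mul1r ltrDl.
have qa : 0 < q a by apply: q0; rewrite inE sa orbT.
have [pa|pa] := leP (p a) 0.
  apply: le_lt_trans qa; rewrite mulr_ge0_le0 // le_min ltW //.
  by rewrite divr_ge0 ?ltW.
by apply: le_lt_trans (tP a sa); rewrite ler_pM2r // ge_min lexx.
Qed.

End FiniteExtrema.

Section Cells.
Variables (R : realType) (n : nat) (A : {fset 'rV[R]_n}) (w : 'rV[R]_n -> R).
Implicit Types (x : 'rV[R]_n) (u d : 'cV[R]_n) (s t : {fset 'rV[R]_n}).

Definition feasible u := forall a, a \in A -> ev a u <= w a.

Definition tight u : {fset 'rV[R]_n} := [fset a in A | ev a u == w a]%fset.

Definition cells : {fset {fset 'rV[R]_n}} :=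
  [fset s in fpowerset A |
    (s != fset0) && `[< exists2 u, feasible u & tight u = s >]]%fset.

Definition generic := forall u, feasible u -> independent (tight u).

Lemma in_sep s (p : pred 'rV[R]_n) a :
  (a \in [fset b in s | p b]%fset) = (a \in s) && p a.
Proof. by rewrite !inE. Qed.

Lemma in_tight u a : (a \in tight u) = (a \in A) && (ev a u == w a).
Proof. exact: in_sep. Qed.

Lemma tight_sub u : (tight u `<=` A)%fset.
Proof. by apply/fsubsetP => a; rewrite in_tight => /andP[]. Qed.

Lemma tight_ev u a : a \in tight u -> ev a u = w a.
Proof. by rewrite in_tight => /andP[_ /eqP]. Qed.

Lemma cellsP s :
  s \in cells <-> s != fset0 /\ exists2 u, feasible u & tight u = s.
Proof.
rewrite !inE /=; split=> [/andP[_ /andP[s0 /asboolP us]]//|[s0 us]].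
rewrite s0; apply/and3P; split=> //; last by apply/asboolP.
by have [u _ <-] := us; rewrite fpowersetE tight_sub.
Qed.

(** Moving by a small amount keeps the slack constraints slack and loosens
    exactly the tight ones on which d is negative. *)
Lemma small_step u d : feasible u ->
  (forall a, a \in tight u -> ev a d <= 0) ->
  exists2 t, 0 < t & feasible (u + t *: d) /\
    tight (u + t *: d) = [fset a in tight u | ev a d == 0]%fset.
Proof.
move=> fu du; pose r := [seq a <- A | a \notin tight u].
have slack a : a \in A -> a \notin tight u -> ev a u < w a.
  by move=> aA; rewrite in_tight aA /= => naw; rewrite lt_neqAle naw fu.
have [|t t0 tP] := @small_scalar _ _ r (fun a => ev a d) (fun a => w a - ev a u).
  by move=> a; rewrite mem_filter subr_gt0 => /andP[? ?]; exact: slack.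
have far a : a \in A -> a \notin tight u -> ev a (u + t *: d) < w a.
  move=> aA na; rewrite evDr evZr -ltrBrDl; apply: tP.
  by rewrite mem_filter na.
exists t => //; split=> [a aA|].
  have [ta|na] := boolP (a \in tight u); last by apply/ltW/far.
  by rewrite evDr evZr (tight_ev ta) gerDl pmulr_rle0 ?du.
apply/fsetP => a; rewrite in_sep in_tight.
have [ta|na] := boolP (a \in tight u); last first.
  rewrite andFb; have [aA|//] := boolP (a \in A).
  by rewrite andTb lt_eqF ?far.
rewrite evDr evZr (tight_ev ta) (fsubsetP (tight_sub u)) //=.
by rewrite -subr_eq0 addrC addKr mulf_eq0 gt_eqF.
Qed.

(** The step length is the least ratio of slack to speed over the constraints
    that d approaches; a constraint realizing it becomes tight. *)
Lemma large_step u d a : feasible u ->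
    (forall b, b \in tight u -> ev b d = 0) -> a \in A -> 0 < ev a d ->
  exists2 t, 0 <= t & feasible (u + t *: d) /\ (tight u `<` tight (u + t *: d))%fset.
Proof.
move=> fu du aA ad; pose r b := (w b - ev b u) / ev b d.
have [|b [bA bd bP]] := @seq_argmax R _ (enum_fset A)
    (fun b => 0 < ev b d) (fun b => - r b).
  by exists a.
have rb0 : 0 <= r b by apply: divr_ge0; [rewrite subr_ge0 fu | exact: ltW].
exists (r b) => //.
have tb : b \in tight (u + r b *: d).
  by rewrite in_tight bA evDr evZr divfK ?lt0r_neq0 // addrC subrK eqxx.
split=> [c cA|].
  rewrite evDr evZr -lerBrDl; have [cd|cd] := leP (ev c d) 0.
    apply: (@le_trans _ _ 0); last by rewrite subr_ge0 fu.
    exact: mulr_ge0_le0.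
  by rewrite -ler_pdivlMr // -lerN2; exact: bP.
rewrite fproperE; apply/andP; split.
  apply/fsubsetP => c tc; rewrite in_tight (fsubsetP (tight_sub u)) //=.
  by rewrite evDr evZr du // mulr0 addr0 (tight_ev tc).
by apply/negP => /fsubsetP/(_ b tb)/du b0; rewrite b0 ltxx in bd.
Qed.

Hypothesis spanA : spanning A.

(** A nonspanning tight set leaves a direction d that fixes it; up to sign d does
    not decrease the value at x, and following it hits a new constraint. *)
Lemma pivot x u : feasible u -> conv [set` A] x -> ~ spanning (tight u) ->
  exists2 u', feasible u' & ev x u <= ev x u' /\ (tight u `<` tight u')%fset.
Proof.
move=> fu /conv_fsetP[c [c0 _ xE]] nsp.
have [d [du d0]] : exists d, (forall a, a \in tight u -> ev a d = 0) /\ d != 0.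
  apply: contrapT => nd; apply: nsp => d du; apply/eqP/negP => d0.
  by apply: nd; exists d; split=> //; apply/negP.
have step e : (forall a, a \in tight u -> ev a e = 0) -> 0 <= ev x e ->
    (exists2 a, a \in A & 0 < ev a e) -> exists2 u', feasible u' &
    ev x u <= ev x u' /\ (tight u `<` tight u')%fset.
  move=> eu xe [a aA ae]; have [t t0 [ft tt]] := large_step fu eu aA ae.
  by exists (u + t *: e) => //; split=> //; rewrite evDr evZr lerDl mulr_ge0.
wlog xd : d du d0 / 0 <= ev x d.
  move=> W; have [/W|/ltW xd] := leP 0 (ev x d); first exact.
  apply: (W (- d)); rewrite ?oppr_eq0 ?evNr ?oppr_ge0 // => a /du.
  by rewrite evNr => ->; rewrite oppr0.
have [pos|npos] := pselect (exists2 a, a \in A & 0 < ev a d); first exact: (step d).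
have neg a : a \in A -> ev a d <= 0.
  by move=> aA; rewrite leNgt; apply/negP => ad; apply: npos; exists a.
(* Every point of A has a nonpositive value, hence so does the convex
   combination x: the direction - d does not decrease the objective either. *)
have xd0 : ev x d <= 0.
  rewrite xE ev_sum big_seq; apply: sumr_le0 => a aA.
  by rewrite mulr_ge0_le0 ?c0 ?neg.
apply: (step (- d)) => [a /du||].
- by rewrite evNr => ->; rewrite oppr0.
- by rewrite evNr oppr_ge0.
- apply: contrapT => npos'; case/eqP: d0; apply: spanA => a aA.
  apply/eqP; rewrite eq_le neg //= leNgt -oppr_gt0 -evNr; apply/negP => ad.
  by apply: npos'; exists a.
Qed.

Lemma vertex_above x u : feasible u -> conv [set` A] x ->
  exists2 u', feasible u' & spanning (tight u') /\ ev x u <= ev x u'.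
Proof.
move=> + Ax; have [k] := ubnP (#|` A| - #|` tight u|)%N.
elim: k u => // k ih u; rewrite ltnS => uk fu.
have [sp|nsp] := pselect (spanning (tight u)); first by exists u.
have [u' fu' [xu tu]] := pivot fu Ax nsp.
have [|v fv [sv xv]] := ih u' _ fu'; last first.
  by exists v => //; split=> //; exact: le_trans xv.
apply: leq_trans uk; apply: ltn_sub2l; last exact: fproper_ltn_card.
exact: leq_trans (fproper_ltn_card tu) (fsubset_leq_card (tight_sub _)).
Qed.

(** A spanning tight set determines its functional, so there are finitely many
    vertices, and every feasible functional is dominated at x by one of them. *)
Lemma optimum x : conv [set` A] x -> (exists u, feasible u) ->
  exists u, [/\ feasible u, spanning (tight u)
    & forall u', feasible u' -> ev x u' <= ev x u].
Proof.
move=> Ax [u0 fu0].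
(* The function g picks the vertex with a given tight set, which turns the
   maximum over vertices into one over the finitely many subsets of A. *)
pose Q s u := [/\ feasible u, spanning (tight u) & tight u = s].
have /choice[g gP] : forall s, exists u, (exists v, Q s v) -> Q s u.
  by move=> s; have [[u]|nu] := pselect (exists v, Q s v); [exists u|exists 0].
have power u : tight u \in enum_fset (fpowerset A).
  by rewrite fpowersetE tight_sub.
have gE u : feasible u -> spanning (tight u) -> ev x (g (tight u)) = ev x u.
  move=> fu su; have [|fg sg tg] := gP (tight u); first by exists u.
  apply/eqP; rewrite -subr_eq0 -evBr (_ : _ - _ = 0) ?ev0r //; apply: su => a ta.
  by rewrite evBr (tight_ev ta) tight_ev ?subrr ?tg.
have [|s [_ sQ sP]] := @seq_argmax R _ (enum_fset (fpowerset A))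
    (fun s => exists v, Q s v) (fun s => ev x (g s)).
  have [u fu [su _]] := vertex_above fu0 Ax.
  by exists (tight u) => //; exists u.
have [fg sg tg] := gP _ sQ; exists (g s); split=> // u fu.
have [v fv [sv xv]] := vertex_above fu Ax.
by rewrite (le_trans xv) // -gE //; apply: sP => //; exists v.
Qed.

Lemma feasible_exists (sg : 'cV[R]_n) :
  (forall a, a \in A -> ev a sg = 1) -> exists u, feasible u.
Proof.
move=> sg1; exists ((- \sum_(a <- A) `|w a|) *: sg) => a aA.
rewrite evZr sg1 // mulr1 lerNl (le_trans (ler_norm _)) // normrN.
by rewrite (big_fsetD1 a) //= lerDl sumr_ge0.
Qed.

End Cells.

(** * Cells of generic weights form a triangulation *)

Section Triangulation.
Variables (R : realType) (n : nat) (A : {fset 'rV[R]_n}) (w : 'rV[R]_n -> R).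
Variable (sg : 'cV[R]_n).
Hypothesis sgA : forall a, a \in A -> ev a sg = 1.
Hypothesis spanA : spanning A.
Hypothesis genw : generic A w.
Implicit Types (x : 'rV[R]_n) (u d : 'cV[R]_n) (s t : {fset 'rV[R]_n}).

Lemma conv_tight u x : conv [set` tight A w u] x -> conv [set` A] x.
Proof.
apply: conv_subset => a ta; apply: conv_fset_mem.
exact: (fsubsetP (tight_sub A w u)).
Qed.

Lemma ev_tight_sum (s : {fset 'rV[R]_n}) (c : 'rV[R]_n -> R) u :
    s = tight A w u ->
  ev (\sum_(a <- s) c a *: a) u = \sum_(a <- s) c a * w a.
Proof.
move=> ->; rewrite ev_sum big_seq [RHS]big_seq; apply: eq_bigr => a ta.
by rewrite (tight_ev ta).
Qed.

Lemma independent_affinely s : independent s -> affinely_independent s.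
Proof. by move=> ind c _; exact: ind. Qed.

Lemma cell_independent s : s \in cells A w -> independent s.
Proof. by move=> /cellsP[_ [u fu <-]]; exact: genw. Qed.

(** Lowering u on the points of s outside t, and keeping its values on t, makes t
    the tight set; independence of s allows both at once. *)
Lemma face_cell s t :
  s \in cells A w -> t != fset0 -> (t `<=` s)%fset -> t \in cells A w.
Proof.
move=> sT t0 ts; have ind := cell_independent sT.
have [_ [u fu us]] := (cellsP _ _ _).1 sT.
have [d dP] := independent_prescribe (fun a => if a \in t then 0 else -1) ind.
have [|e e0 [fe te]] := small_step fu (d := d).
  by move=> a; rewrite us => /dP->; case: ifP => // _; rewrite oppr_le0.
apply/cellsP; split=> //; exists (u + e *: d) => //; rewrite te.
apply/fsetP => a; rewrite in_sep us; apply/andP/idP => [[sa]|ta].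
  by rewrite dP //; case: ifP => // _; rewrite oppr_eq0 oner_eq0.
by have sa := fsubsetP ts _ ta; rewrite dP // ta.
Qed.

(** The common value of the two linear functionals at a point of both cells
    forces complementary slackness: only vertices tight for both functionals
    can carry a positive coefficient. *)
Lemma inter_cells s t : s \in cells A w -> t \in cells A w ->
  conv [set` s] `&` conv [set` t] = conv [set` (s `&` t)%fset].
Proof.
move=> /cellsP[_ [u fu su]] /cellsP[_ [v fv tv]].
apply/seteqP; split=> [x []|x xst]; last first.
  by split; apply: conv_subset xst => a;
    rewrite inE => /andP[sa ta]; exact: conv_fset_mem.
move=> /conv_fsetP[c [c0 c1 xc]] /conv_fsetP[e [e0 e1 xe]].
have sA a : a \in s -> a \in A by rewrite -su => /(fsubsetP (tight_sub _ _ _)).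
have tA a : a \in t -> a \in A by rewrite -tv => /(fsubsetP (tight_sub _ _ _)).
have xu : ev x u = \sum_(a <- s) c a * w a by rewrite xc (ev_tight_sum _ (esym su)).
have xv : ev x v = \sum_(a <- t) e a * w a by rewrite xe (ev_tight_sum _ (esym tv)).
have uv : ev x u <= ev x v.
  rewrite xv xe ev_sum big_seq [leRHS]big_seq; apply: ler_sum => a ta.
  by rewrite ler_wpM2l ?e0 ?fu ?tA.
have gap a : a \in s -> 0 <= c a * (w a - ev a v).
  by move=> sa; rewrite mulr_ge0 ?c0 ?subr_ge0 ?fv ?sA.
have gap0 : \sum_(a <- s) c a * (w a - ev a v) <= 0.
  under eq_bigr => a _ do rewrite mulrBr.
  by rewrite sumrB -xu -ev_sum -xc subr_le0.
have c_out a : a \in s -> a \notin t -> c a = 0.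
  move=> sa nta; have : c a * (w a - ev a v) <= 0.
    apply: le_trans gap0; rewrite (big_fsetD1 a) //= lerDl big_seq.
    by apply: sumr_ge0 => b; rewrite inE => /andP[_ sb]; exact: gap.
  rewrite le_eqVlt ltNge gap // orbF mulf_eq0 => /orP[/eqP//|].
  by rewrite subr_eq0 eq_sym => wa; case/negP: nta; rewrite -tv in_tight sA.
have restrict (U : lmodType R) (F : 'rV[R]_n -> U) :
    \sum_(a <- (s `&` t)%fset) c a *: F a = \sum_(a <- s) c a *: F a.
  apply: big_fset_incl; first exact: fsubsetIl.
  by move=> a sa; rewrite inE sa /= => nta; rewrite c_out ?scale0r.
apply/conv_fsetP; exists c; split=> [a|| //].
- by rewrite inE => /andP[sa _]; exact: c0.
- have := restrict R^o (fun=> 1); rewrite /GRing.scale /=.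
  by under eq_bigr do rewrite mulr1; under [RHS]eq_bigr do rewrite mulr1; rewrite c1.
- by rewrite (restrict _ id).
Qed.

(** Linear programming duality: the functional maximizing the value at x has a
    tight set which is a basis; a negative coefficient of x on this basis would
    give a direction of improvement. *)
Lemma cover_cells x : conv [set` A] x -> exists2 s, s \in cells A w & conv [set` s] x.
Proof.
move=> Ax; have [u [fu su uP]] := optimum spanA Ax (feasible_exists w sgA).
have ind := genw fu.
have xsg : ev x sg = 1.
  have /conv_fsetP[c [_ c1 ->]] := Ax; rewrite ev_sum -[RHS]c1.
  by rewrite big_seq [RHS]big_seq; apply: eq_bigr => a aA; rewrite sgA ?mulr1.
have [c xc] := spanning_sum x su.
have sc : \sum_(a <- tight A w u) c a = 1.
  rewrite -xsg xc ev_sum big_seq [RHS]big_seq; apply: eq_bigr => a ta.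
  by rewrite sgA ?mulr1 // (fsubsetP (tight_sub _ _ _) a ta).
exists (tight A w u).
  apply/cellsP; split; last by exists u.
  by apply/eqP => t0; move: sc; rewrite t0 big_seq_fset0 => /esym/eqP; rewrite oner_eq0.
apply/conv_fsetP; exists c; split=> // b tb.
have [d dP] := independent_prescribe (fun a => if a == b then -1 else 0) ind.
have [|e e0 [fe _]] := small_step fu (d := d).
  by move=> a /dP->; case: ifP => // _; rewrite oppr_le0.
have := uP _ fe; rewrite evDr gerDl evZr pmulr_rle0 //.
rewrite [in ev x d]xc ev_sum (big_fsetD1 b) //= dP // eqxx mulrN1.
rewrite big_seq big1 ?addr0 ?oppr_le0 // => a; rewrite !inE => /andP[ab].
by move=> ta; rewrite dP ?in_tight // (negbTE ab) mulr0.
Qed.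

Lemma cells_triangulation : (forall a, a \in A -> int_points R n a) ->
  lattice_triangulation (conv [set` A]) (cells A w).
Proof.
move=> intA; split.
- by move=> s /cellsP[].
- by move=> s /cell_independent/independent_affinely.
- by move=> s /cellsP[_ [u _ <-]] a /(fsubsetP (tight_sub _ _ _))/intA.
- exact: face_cell.
- exact: inter_cells.
- apply/seteqP; split=> [x /cover_cells[s sT xs]|x [s /= sT]]; first by exists s.
  by move: sT => /cellsP[_ [u _ <-]]; exact: conv_tight.
Qed.

End Triangulation.

(** * Generic weights *)

Section Perturbation.
Variable (R : realType).

Lemma avoid_roots (ps : seq {poly R}) (b : R) : 0 < b ->
  (forall p, p \in ps -> p != 0) ->
  exists2 e, 0 < e < b & forall p, p \in ps -> p.[e] != 0.
Proof.
move=> b0 ps0; pose q := \prod_(p <- ps) p.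
have q0 : q != 0.
  by rewrite prodf_seq_neq0; apply/allP => p /ps0.
pose pts := [seq b / k.+2%:R | k <- iota 0 (size q)].
have upts : uniq pts.
  rewrite map_inj_uniq ?iota_uniq // => i j /(mulfI (lt0r_neq0 b0))/invr_inj/eqP.
  by rewrite eqr_nat => /eqP[].
have := max_poly_roots q0 _ upts; rewrite size_map size_iota ltnn => nall.
have /allPn[e /mapP[k _ ->] qe] : ~~ all (root q) pts by apply/negP => /nall.
exists (b / k.+2%:R); first by rewrite divr_gt0 //= ltr_pdivrMr // ltr_pMr // ltr1n.
move=> p pps; apply: contraNneq qe => pe0.
by rewrite /root /q (big_rem p) //= hornerM pe0 mul0r.
Qed.

(** The perturbation adds distinct powers of a small parameter to the weights.
    A dependent tight set would make the corresponding combination of weights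
    vanish, so the parameter would be a root of one of finitely many nonzero
    polynomials. *)
Lemma generic_weight (n : nat) (A : {fset 'rV[R]_n}) (w0 : 'rV[R]_n -> R)
    (b : R) : 0 < b ->
  exists2 w, (forall a, a \in A -> `|w a - w0 a| < b) & generic A w.
Proof.
move=> b0.
pose dep (s : {fset 'rV[R]_n}) (c : 'rV[R]_n -> R) :=
  \sum_(a <- s) c a *: a = 0 /\ exists2 a, a \in s & c a != 0.
have /choice[c cP] : forall s, exists c, ~ independent s -> dep s c.
  move=> s; have [ind|/existsNP[c]] := pselect (independent s).
    by exists (fun=> 0).
  move=> nc; exists c => _; split.
    by apply: contrapT => c0; apply: nc => /c0.
  apply: contrapT => na; apply: nc => c0 a sa; apply/eqP/negPn/negP => ca.
  by apply: na; exists a.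
pose P (s : {fset 'rV[R]_n}) : {poly R} := (\sum_(a <- s) c s a * w0 a)%:P +
   \sum_(a <- s) c s a *: 'X ^+ (index a A).+1.
pose ps := [seq P s | s <- fpowerset A & `[< ~ independent s >]].
have [|p /mapP[s + ->]|e /andP[e0 eb] eP] := @avoid_roots ps (Num.min b 1).
- by rewrite lt_min b0 ltr01.
- rewrite mem_filter fpowersetE => /andP[/asboolP/cP[_ [a sa ca]] /fsubsetP sA].
  apply: contraNneq ca => Ps0; have := congr1 (fun p : {poly R} => p`_(index a A).+1) Ps0.
  rewrite coefD coefC /= add0r coef_sum coef0 (big_fsetD1 a) //= coefZ coefXn eqxx mulr1.
  rewrite big_seq big1 ?addr0 => [->//|d]; rewrite !inE => /andP[da sd].
  rewrite coefZ coefXn eqSS; case: eqP => [ia|]; last by rewrite mulr0.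
  case/eqP: da; rewrite -(nth_index 0 (sA _ sd)) -ia nth_index //; exact: sA.
exists (fun a => w0 a + e ^+ (index a A).+1) => [a aA|u fu].
  rewrite addrC addKr ger0_norm ?exprn_ge0 ?ltW //.
  move: eb; rewrite lt_min => /andP[eb e1]; apply: le_lt_trans eb.
  by rewrite exprS ler_piMr ?exprn_ile1 ?ltW.
apply: contrapT => ndep; set t := tight _ _ u in ndep.
have [c0 _] := cP _ ndep.
have /eP : P t \in ps.
  by apply: map_f; rewrite mem_filter fpowersetE tight_sub andbT; apply/asboolP.
rewrite hornerD hornerC horner_sum -big_split /= => /eqP; apply.
rewrite -[RHS](ev0l u) -c0 ev_sum big_seq [RHS]big_seq; apply: eq_bigr => a ta.
by rewrite (tight_ev ta) hornerZ hornerXn -mulrDr.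
Qed.

End Perturbation.

(** * Cells as projected lower faces *)

Section Regularity.
Variables (R : realType) (n : nat) (A : {fset 'rV[R]_n}) (w : 'rV[R]_n -> R).
Variable (sg : 'cV[R]_n).
Hypothesis sgA : forall a, a \in A -> ev a sg = 1.
Hypothesis intA : forall a, a \in A -> int_points R n a.
Implicit Types (x p : 'rV[R]_n) (u d : 'cV[R]_n).

Let P := conv [set` A].

(** Lattice points outside A receive a height above the values that a linear
    functional bounded by w on A can take, so that they stay off the lower hull. *)
Definition height p := if p \in A then w p else 1 + \sum_(a <- A) `|w a|.

Definition lifted p : 'rV[R]_(n + 1) := row_mx p (height p)%:M.

(** The functional measuring how far a lifted point is above the graph of u. *)
Definition slope u : 'cV[R]_(n + 1) := col_mx (- u) 1%:M.

Let Q := lifted_polytope P height.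

Lemma ev_row_col p (h m : R) u :
  ev (row_mx p h%:M) (col_mx u m%:M) = ev p u + h * m.
Proof.
rewrite /ev mul_row_col mxE -scalar_mxM. by rewrite [X in _ + X]mxE eqxx mulr1n.
Qed.

Lemma ev_lift p u : ev (lifted p) (slope u) = height p - ev p u.
Proof. by rewrite ev_row_col evNr mulr1 addrC. Qed.

Lemma conv_sg p : P p -> ev p sg = 1.
Proof.
move=> /conv_fsetP[c [_ c1 ->]]; rewrite ev_sum -[RHS]c1.
by rewrite big_seq [RHS]big_seq; apply: eq_bigr => a aA; rewrite sgA ?mulr1.
Qed.

Lemma below_height u p : feasible A w u -> P p ->
  ev p u <= height p ?= iff (p \in tight A w u).
Proof.
move=> fu Pp; apply/leifP; rewrite in_tight /height.
case: (boolP (p \in A)) => [pA|_] /=.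
  by case: eqP => // /eqP ne; rewrite lt_neqAle ne fu.
have /conv_fsetP[c [c0 c1 ->]] := Pp.
apply: (@le_lt_trans _ _ (\sum_(a <- A) `|w a|)); last by rewrite ltrDr.
rewrite ev_sum big_seq [leRHS]big_seq; apply: ler_sum => a aA.
apply: (le_trans (ler_wpM2l (c0 a aA) (fu a aA))).
apply: (le_trans (ler_norm _)); rewrite normrM ger0_norm ?c0 // ler_piMl //.
rewrite -c1 (big_fsetD1 a) //= lerDl big_seq.
by apply: sumr_ge0 => b; rewrite inE => /andP[_ /c0].
Qed.

Lemma lift_in p : P p -> int_points R n p -> Q (lifted p).
Proof.
move=> Pp ip; exists 1%N, (fun=> lifted p), (fun=> 1); split=> //.
- by move=> _; exists p.
- by rewrite big_ord1.
- by rewrite big_ord1 scale1r.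
Qed.

Lemma lift_mem a : a \in A -> Q (lifted a).
Proof. by move=> aA; apply: lift_in; [exact: conv_fset_mem | exact: intA]. Qed.

Lemma lifted_pointsP y : Q y -> exists (m : nat) (q : 'I_m -> 'rV[R]_n) (c : 'I_m -> R),
  [/\ forall i, P (q i), forall i, 0 <= c i, \sum_i c i = 1
    & y = \sum_i c i *: lifted (q i)].
Proof.
move=> [m [p [c [pP c0 c1 ->]]]].
have /choice[q qP] : forall i, exists q, P q /\ lifted q = p i.
  by move=> i; have [q [Pq _] <-] := pP i; exists q.
exists m, q, c; split=> // [i|]; first by have [] := qP i.
by apply: eq_bigr => i _; have [_ ->] := qP i.
Qed.

Lemma lsubmx_lift m (c : 'I_m -> R) (q : 'I_m -> 'rV[R]_n) :
  lsubmx (\sum_i c i *: lifted (q i)) = \sum_i c i *: q i.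
Proof.
apply/rowP => j; rewrite mxE !summxE; apply: eq_bigr => i _.
by rewrite mxE row_mxEl mxE.
Qed.

Lemma lsubmx_sg y : Q y -> ev (lsubmx y) sg = 1.
Proof.
move=> /lifted_pointsP[m [q [c [qP _ c1 ->]]]].
rewrite lsubmx_lift ev_sum -[RHS]c1.
by apply: eq_bigr => i _; rewrite conv_sg ?mulr1.
Qed.

Definition zero_face u := [set y | Q y /\ ev y (slope u) = 0].

Lemma slope_ge0 u y : feasible A w u -> Q y -> 0 <= ev y (slope u).
Proof.
move=> fu /lifted_pointsP[m [q [c [qP c0 _ ->]]]]; rewrite ev_sum.
apply: sumr_ge0 => i _; rewrite mulr_ge0 // ev_lift subr_ge0.
by rewrite (below_height fu (qP i)).
Qed.

(** A combination of lifted points is on the graph of u only if every point with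
    a nonzero coefficient is, since none is below the graph. *)
Lemma zero_faceE u : feasible A w u ->
  lsubmx @` zero_face u = conv [set` tight A w u].
Proof.
move=> fu; apply/seteqP; split=> [_ [y [Qy y0] <-]|x [m [p [c [pt c0 c1 ->]]]]].
  have [m [q [c [qP c0 c1 yE]]]] := lifted_pointsP Qy.
  rewrite yE lsubmx_lift.
  have gap i : c i != 0 -> q i \in tight A w u.
    move=> ci; have [_ <-] := below_height fu (qP i).
    rewrite eq_sym -subr_eq0 -ev_lift.
    have : \sum_i c i * ev (lifted (q i)) (slope u) == 0 by rewrite -ev_sum -yE y0.
    rewrite psumr_eq0 => [/allP/(_ i)|j _].
      by rewrite mem_index_enum mulf_eq0 (negbTE ci) => /(_ isT).
    by rewrite mulr_ge0 // ev_lift subr_ge0 (below_height fu (qP j)).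
  have [i0 ci0] : exists i, c i != 0.
    apply: contrapT => nc; have /eqP := c1; rewrite big1 ?(eq_sym 0) ?oner_eq0 // => i _.
    by apply/eqP/negPn/negP => ci; apply: nc; exists i.
  (* The definition of a convex hull asks for points of the set even where the
     coefficient vanishes: such points are replaced by a tight one. *)
  exists m, (fun i => if c i == 0 then q i0 else q i), c; split=> // [i|].
    by rewrite /=; case: ifP => [_|/negbT/gap//]; exact: gap.
  by apply: eq_bigr => i _; case: eqP => [->|//]; rewrite !scale0r.
have ptA i : p i \in A by exact: (fsubsetP (tight_sub A w u)) (pt i).
exists (\sum_i c i *: lifted (p i)); last exact: lsubmx_lift.
split.
  exists m, (fun i => lifted (p i)), c; split=> // i; exists (p i) => //.
  by split; [exact: conv_fset_mem | exact: intA].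
rewrite ev_sum big1 // => i _; rewrite ev_lift /height ptA.
by rewrite (tight_ev (pt i)) subrr mulr0.
Qed.

Lemma zero_face_minimizing u : feasible A w u -> zero_face u !=set0 ->
  zero_face u = face_minimizing Q (slope u).
Proof.
move=> fu [y0 [Qy0 y00]]; apply/seteqP; split=> y [Qy yP]; split=> //.
  by move=> z /(slope_ge0 fu); rewrite -yP.
by apply/eqP; rewrite eq_le slope_ge0 // andbT -y00; exact: yP.
Qed.

Lemma tight_nonempty u : feasible A w u ->
  tight A w u != fset0 <-> zero_face u !=set0.
Proof.
move=> fu; split=> [/fset0Pn[a ta]|[y yF]].
  have : (lsubmx @` zero_face u) a by rewrite zero_faceE //; exact: conv_fset_mem.
  by move=> [y yF _]; exists y.
have : conv [set` tight A w u] (lsubmx y) by rewrite -zero_faceE //; exists y.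
move=> /conv_fsetP[c [_ + _]]; apply: contra_eq_neq => ->.
by rewrite big_seq_fset0 eq_sym oner_eq0.
Qed.

(** A functional with positive last coordinate is, on the lifted polytope and
    up to a positive factor and an additive constant, the height above the graph
    of a linear functional; the constant is absorbed because the polytope lies
    in an affine hyperplane missing the origin. *)
Lemma slope_of_functional (U : 'cV[R]_(n + 1)) (m : R) :
  0 < U (rshift n 0) 0 -> exists u, exists2 k, 0 < k &
    forall y, Q y -> ev y U - m = k * ev y (slope u).
Proof.
set k := U (rshift n 0) 0 => k0.
exists (k^-1 *: (m *: sg - usubmx U)), k => // y Qy.
have UE : U = col_mx (usubmx U) k%:M.
  by rewrite -[LHS]vsubmxK; congr col_mx; rewrite [LHS]mx11_scalar !mxE.
have yE : y = row_mx (lsubmx y) (rsubmx y 0 0)%:M.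
  by rewrite -[LHS]hsubmxK -mx11_scalar.
rewrite yE {1}UE !ev_row_col evNr evZr evBr evZr lsubmx_sg //.
by field; exact: lt0r_neq0.
Qed.

Lemma cells_regular : regular P (cells A w).
Proof.
exists height; apply/seteqP; split=> C.
  move=> [s /= /cellsP[s0 [u fu us]] <-]; rewrite -us -zero_faceE //.
  rewrite -us in s0; have F0 := (tight_nonempty fu).1 s0.
  exists (zero_face u) => //; split=> //; exists (slope u); split.
    by rewrite col_mxEd mxE eqxx ltr01.
  exact: zero_face_minimizing.
move=> [F [F0 [U [k0 FE]]] <-]; have [y0] := F0; rewrite {1}FE => -[Qy0 y0min].
have [u [k k0' uP]] := slope_of_functional (ev y0 U) k0.
have fu : feasible A w u.
  move=> a aA; have := y0min _ (lift_mem aA); rewrite -subr_ge0 => ge0.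
  have : 0 <= k * ev (lifted a) (slope u) by rewrite -uP //; exact: lift_mem.
  by rewrite pmulr_rge0 // ev_lift /height aA subr_ge0.
have FE' : F = zero_face u.
  rewrite FE; apply/seteqP; split=> y [Qy yP]; split=> //.
    apply/eqP; rewrite -(mulrI_eq0 _ (lregP (lt0r_neq0 k0'))) -uP // subr_eq0.
    by rewrite eq_le (yP _ Qy0) y0min.
  move=> z Qz; apply: le_trans (y0min _ Qz); rewrite -subr_le0.
  by have := uP _ Qy; rewrite yP mulr0 /ev => ->.
exists (tight A w u); last by rewrite FE' zero_faceE.
apply/cellsP; split; last by exists u.
by apply/(tight_nonempty fu); rewrite -FE'.
Qed.

End Regularity.

(** * Simplices generating the integer lattice *)

Section Unimodularity.
Variables (R : realType) (n : nat).
Implicit Types (x y : 'rV[R]_n) (s A : {fset 'rV[R]_n}).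

(** Pivoting from a nonspanning cell yields a strictly larger one. *)
Lemma maximal_cell_spanning A (w : 'rV[R]_n -> R) s : spanning A ->
    s \in cells A w -> (forall t, t \in cells A w -> ~~ (s `<` t)%fset) ->
  spanning s.
Proof.
move=> spA /cellsP[s0 [u fu us]] smax; apply: contrapT => nsp.
have /fset0Pn[a sa] := s0.
have aA : conv [set` A] a.
  by apply: conv_fset_mem; apply: (fsubsetP (tight_sub A w u)); rewrite us.
have [|v fv [_]] := pivot spA fu aA; rewrite us // => sv.
have vT : tight A w v \in cells A w.
  apply/cellsP; split; last by exists v.
  by apply: contraTneq sv => ->; rewrite fproperE fsub0set andbF.
by have := smax _ vT; rewrite sv.
Qed.

Definition intspan s x := exists z : 'rV[R]_n -> int, x = \sum_(a <- s) (z a)%:~R *: a.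

Lemma intspanB s x y : intspan s x -> intspan s y -> intspan s (x - y).
Proof.
move=> [z ->] [t ->]; exists (fun a => z a - t a); rewrite -sumrB.
by apply: eq_bigr => a _; rewrite rmorphB scalerBl.
Qed.

Lemma intspan0 s : intspan s 0.
Proof. by exists (fun=> 0); rewrite big1 // => a _; rewrite scale0r. Qed.

Lemma intspanD s x y : intspan s x -> intspan s y -> intspan s (x + y).
Proof.
move=> sx sy; rewrite -[y]opprK -[- y]sub0r.
by apply: intspanB => //; apply: intspanB => //; exact: intspan0.
Qed.

Lemma intspanZ s (k : int) x : intspan s x -> intspan s (k%:~R *: x).
Proof.
move=> [z ->]; exists (fun a => k * z a); rewrite scaler_sumr.
by apply: eq_bigr => a _; rewrite rmorphM scalerA.
Qed.

Lemma intspan_mem s a : a \in s -> intspan s a.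
Proof.
move=> sa; exists (fun b => (b == a)%:R); rewrite (big_fsetD1 a) //= eqxx scale1r.
rewrite big_seq big1 ?addr0 // => b; rewrite !inE => /andP[/negbTE-> _].
by rewrite scale0r.
Qed.

Lemma intspan_int s :
  (forall k, intspan s (delta_mx 0 k)) -> forall x, int_points R n x -> intspan s x.
Proof.
move=> sk x /mxOverP ix; rewrite (row_sum_delta x).
elim/big_ind: _ => [|p q|k _]; [exact: intspan0 | exact: intspanD |].
by have /intrP[z ->] := ix 0 k; exact: intspanZ.
Qed.

Lemma int_points_sum (I : finType) (z : I -> int) (p : I -> 'rV[R]_n) :
  (forall i, int_points R n (p i)) -> int_points R n (\sum_i (z i)%:~R *: p i).
Proof.
move=> ip; apply/mxOverP => i j; rewrite summxE; apply: rpred_sum => k _.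
by rewrite mxE rpredM ?rpred_int //; exact: (mxOverP (ip k)).
Qed.

(** The coefficients on the vertices of a simplex of the combination with
    coefficients c of its edge vectors at vertex 0. *)
Definition fan_coef (U : zmodType) d (c : 'I_d -> U) (i : 'I_d.+1) : U :=
  if unlift ord0 i is Some j then c j else - \sum_j c j.

Lemma fan_coef0 (U : zmodType) d (c : 'I_d -> U) : fan_coef c ord0 = - \sum_j c j.
Proof. by rewrite /fan_coef unlift_none. Qed.

Lemma fan_coefS (U : zmodType) d (c : 'I_d -> U) j : fan_coef c (lift ord0 j) = c j.
Proof. by rewrite /fan_coef liftK. Qed.

Lemma sum_fan_coef (U : zmodType) d (c : 'I_d -> U) : \sum_i fan_coef c i = 0.
Proof.
rewrite big_ord_recl fan_coef0 addrC; under eq_bigr do rewrite fan_coefS.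
exact: addrN.
Qed.

Lemma fan_sum d (c : 'I_d -> R) (v : 'I_d.+1 -> 'rV[R]_n) :
  \sum_i c i *: (v (lift ord0 i) - v ord0) = \sum_i fan_coef c i *: v i.
Proof.
rewrite big_ord_recl fan_coef0 scaleNr scaler_suml addrC -sumrB.
by apply: eq_bigr => i _; rewrite fan_coefS scalerBr.
Qed.

(** When the vertices generate the integer lattice, the edge vectors at one
    vertex are a basis of the lattice of the affine hull, and the matrix of the
    edge vectors in this basis is the identity. *)
Lemma unimodular_simplex A (sg : 'cV[R]_n) s :
    (forall a, a \in A -> ev a sg = 1) ->
    (forall a, a \in A -> int_points R n a) ->
    s != fset0 -> (s `<=` A)%fset -> independent s ->
    (forall x, int_points R n x -> intspan s x) ->
  normalized_volume (int_points R n `&` aff (conv [set` A])) s 1.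
Proof.
move=> sgA intA s0 /fsubsetP sA ind gen.
have [d sd] : exists d, size s = d.+1.
  by move: s0; rewrite -cardfs_gt0; case: (size s) => // d _; exists d.
pose v (i : 'I_d.+1) := nth 0 s i.
have vs i : v i \in s by rewrite mem_nth // sd.
have sumv (U : zmodType) (F : 'rV[R]_n -> U) : \sum_(a <- s) F a = \sum_i F (v i).
  by rewrite (big_nth 0) sd big_mkord.
have indv (e : 'I_d.+1 -> R) : \sum_i e i *: v i = 0 -> forall i, e i = 0.
  move=> e0 i; pose f a := e (inord (index a s)).
  have fv j : f (v j) = e j by rewrite /f index_uniq ?fset_uniq ?sd // inord_val.
  rewrite -fv; apply: ind => //; rewrite sumv -[RHS]e0.
  by apply: eq_bigr => j _; rewrite fv.
pose B : 'M[R]_(d, n) := \matrix_(i < d) (v (lift ord0 i) - v ord0).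
have mulB (c : 'rV[R]_d) : c *m B = \sum_i fan_coef (c 0) i *: v i.
  rewrite -fan_sum mulmx_sum_row; apply: eq_bigr => i _.
  by rewrite rowK.
have freeB : row_free B.
  rewrite -kermx_eq0; apply/rowV0P => c /sub_kermxP; rewrite mulB => /indv c0.
  by apply/rowP => j; rewrite mxE -(fan_coefS (c 0)) c0.
have affsg x : aff (conv [set` A]) x -> ev x sg = 1.
  move=> [m [p [c [pA c1 ->]]]]; rewrite ev_sum -[RHS]c1.
  by apply: eq_bigr => i _; rewrite (conv_sg sgA (pA i)) mulr1.
have Pv i : conv [set` A] (v i) by apply/conv_fset_mem/sA.
have affv (e : 'I_d.+1 -> R) : \sum_i e i = 1 -> aff (conv [set` A]) (\sum_i e i *: v i).
  by move=> e1; exists d.+1, v, e.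
have intv i : int_points R n (v i) by apply/intA/sA.
exists d, B, v, 1%:M; split; last by rewrite det1 normr1.
- split=> //; apply/seteqP; split=> [_ [x [ix ax] [y [iy ay] <-]]|_ [z _ <-]].
    have [|c cE] := gen (x - y).
      by apply/mxOverP => i j; rewrite mxE [X in _ + X]mxE rpredB //; exact: mxOverP.
    have c0 : \sum_i c (v i) = 0.
      have : ev (x - y) sg = 0 by rewrite evBl !affsg // subrr.
      rewrite cE ev_sum sumv (eq_bigr (fun i => (c (v i))%:~R)) => [/eqP|i _].
        by rewrite -rmorph_sum intr_eq0 => /eqP.
      by rewrite sgA ?mulr1 //; exact: sA.
    exists (\row_j c (v (lift ord0 j))) => //.
    rewrite mulB cE (sumv _ (fun a => (c a)%:~R *: a)).
    apply: eq_bigr => i _; congr (_ *: _).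
    have [j|] := unliftP ord0 i => [->|->]; first by rewrite fan_coefS !mxE.
    rewrite fan_coef0; under eq_bigr do rewrite !mxE.
    rewrite -rmorph_sum -rmorphN; congr (_%:~R); apply/eqP.
    by rewrite eq_sym -addr_eq0 -[X in _ == X]c0 big_ord_recl.
  have mulz : map_mx intr z *m B = \sum_i (fan_coef (z 0) i)%:~R *: v i.
    rewrite mulB; apply: eq_bigr => i _; congr (_ *: _).
    have [j|] := unliftP ord0 i => [->|->]; first by rewrite !fan_coefS !mxE.
    rewrite !fan_coef0 rmorphN rmorph_sum; congr (- _).
    by apply: eq_bigr => j _; rewrite mxE.
  exists (map_mx intr z *m B + v ord0).
    split.
      apply/mxOverP => i j; rewrite mxE rpredD //; last exact: (mxOverP (intv ord0)).
      by rewrite mulz; apply: (mxOverP (int_points_sum _ intv)).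
    have -> : map_mx intr z *m B + v ord0 =
        \sum_i ((fan_coef (z 0) i)%:~R + (i == ord0)%:R) *: v i.
      under eq_bigr do rewrite scalerDl.
      rewrite big_split /= -mulz (bigD1 ord0) //= scale1r big1 ?addr0 // => i.
      by move=> /negbTE->; rewrite scale0r.
    apply: affv; rewrite big_split /= -rmorph_sum sum_fan_coef rmorph0 add0r.
    rewrite (bigD1 ord0) //= big1 ?addr0 // => i.
    by move=> /negbTE->.
  exists (v ord0); last by rewrite addrK.
  split=> //; apply: (_ : conv [set` A] `<=` aff (conv [set` A])) => // x Px.
  by exists 1%N, (fun=> x), (fun=> 1); rewrite !big_ord1 scale1r.
- split.
    move=> i j /eqP; rewrite nth_uniq ?sd ?fset_uniq // => /eqP; exact: val_inj.
  apply/seteqP; split=> [a /= sa|_ [i _ <-]]; last exact: vs.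
  have ia : (index a s < d.+1)%N by rewrite -sd index_mem.
  by exists (Ordinal ia) => //; rewrite /v /= nth_index.
- by rewrite mul1mx.
Qed.

End Unimodularity.

(** * The cosmological polytope *)

Section CosmologicalPolytope.
Variables (R : realType) (V E : finType) (ends : E -> V * V).
Local Notation n := (#|V| + #|E|)%N.
Local Notation src e := (ends e).1.
Local Notation tgt e := (ends e).2.

Definition xv (v : V) : 'rV[R]_n := vec_v R E v.
Definition xe (e : E) : 'rV[R]_n := vec_e R V e.
Definition edge_sum e := xv (src e) + xv (tgt e) - xe e.
Definition edge_out e := xv (src e) - xv (tgt e) + xe e.
Definition edge_in e := - xv (src e) + xv (tgt e) + xe e.

Definition generators : {fset 'rV[R]_n} :=
  [fset x in flatten
    [seq [:: edge_sum e; edge_out e; edge_in e] | e <- enum E]]%fset.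

Definition points : {fset 'rV[R]_n} :=
  [fset x in [seq xv v | v <- enum V] ++ flatten
    [seq [:: xe e; edge_sum e; edge_out e; edge_in e] | e <- enum E]]%fset.

Lemma generatorsP a : a \in generators <->
  exists e, a \in [:: edge_sum e; edge_out e; edge_in e].
Proof.
rewrite inE /=; split=> [/flattenP[l /mapP[e _ ->] al]|[e ae]]; first by exists e.
by apply/flattenP; exists [:: edge_sum e; edge_out e; edge_in e] => //;
  apply: map_f; rewrite mem_enum.
Qed.

Lemma pointsP a : a \in points <-> (exists v, a = xv v) \/
  exists e, a \in [:: xe e; edge_sum e; edge_out e; edge_in e].
Proof.
rewrite !inE /=; split=> [/orP[/mapP[v _ ->]|/flattenP[l /mapP[e _ ->] al]]|].
- by left; exists v.
- by right; exists e.
move=> [[v ->]|[e ae]]; apply/orP; [left|right].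
  by apply: map_f; rewrite mem_enum.
by apply/flattenP; exists [:: xe e; edge_sum e; edge_out e; edge_in e] => //;
  apply: map_f; rewrite mem_enum.
Qed.

Lemma xv_point v : xv v \in points.
Proof. by apply/pointsP; left; exists v. Qed.
Lemma xe_point e : xe e \in points.
Proof. by apply/pointsP; right; exists e; rewrite !inE eqxx. Qed.

Definition functional (hv : V -> R) (he : E -> R) : 'cV[R]_n :=
  \col_k match split k with
         | inl i => hv (enum_val i) | inr j => he (enum_val j) end.

Lemma ev_delta k (d : 'cV[R]_n) : ev (delta_mx 0 k) d = d k 0.
Proof. by rewrite /ev -rowE mxE. Qed.

Lemma ev_xv v hv he : ev (xv v) (functional hv he) = hv v.
Proof. by rewrite ev_delta mxE (unsplitK (inl _)) enum_rankK. Qed.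

Lemma ev_xe e hv he : ev (xe e) (functional hv he) = he e.
Proof. by rewrite ev_delta mxE (unsplitK (inr _)) enum_rankK. Qed.

Lemma coord_ind (Q : 'rV[R]_n -> Prop) :
  (forall v, Q (xv v)) -> (forall e, Q (xe e)) -> forall k, Q (delta_mx 0 k).
Proof.
move=> Qv Qe k; case: (split_ordP k) => i ->.
  by rewrite -(enum_valK i); exact: Qv.
by rewrite -(enum_valK i); exact: Qe.
Qed.

Definition coord_sum : 'cV[R]_n := functional (fun=> 1) (fun=> 1).

Lemma points_coord_sum a : a \in points -> ev a coord_sum = 1.
Proof.
move=> /pointsP[[v ->]|[e]]; first exact: ev_xv.
rewrite !inE => /or4P[] /eqP->; rewrite ?(evDl, evNl) ?ev_xv ?ev_xe //; ring.
Qed.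

Lemma points_spanning : spanning points.
Proof.
move=> d d0; apply/colP => k; rewrite mxE -ev_delta.
apply: (coord_ind (Q := fun x => ev x d = 0)) => [v|e]; apply: d0.
  exact: xv_point.
exact: xe_point.
Qed.

Lemma points_int a : a \in points -> int_points R n a.
Proof.
have iv v : xv v \is a mxOver Num.int.
  by apply/mxOverP => i j; rewrite mxE; exact: rpred_nat.
have ie e : xe e \is a mxOver Num.int.
  by apply/mxOverP => i j; rewrite mxE; exact: rpred_nat.
have iD (x y : 'rV[R]_n) : x \is a mxOver Num.int -> y \is a mxOver Num.int ->
    x + y \is a mxOver Num.int.
  by move=> /mxOverP ix /mxOverP iy; apply/mxOverP => i j; rewrite mxE rpredD.
have iN (x : 'rV[R]_n) : x \is a mxOver Num.int -> - x \is a mxOver Num.int.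
  by move=> /mxOverP ix; apply/mxOverP => i j; rewrite mxE rpredN.
move=> /pointsP[[v ->]|[e]]; first exact: iv.
rewrite !inE => /or4P[] /eqP->; first exact: ie.
- exact: (iD _ _ (iD _ _ (iv _) (iv _)) (iN _ (ie _))).
- exact: (iD _ _ (iD _ _ (iv _) (iN _ (iv _))) (ie _)).
- exact: (iD _ _ (iD _ _ (iN _ (iv _)) (iv _)) (ie _)).
Qed.

Lemma conv_midpoint (s : {fset 'rV[R]_n}) a b c :
  a \in s -> b \in s -> a + b = c + c -> conv [set` s] c.
Proof.
move=> sa sb abc; exists 2, (fun i => if i == ord0 then a else b), (fun=> 2^-1).
split=> [i|i||]; first by rewrite /=; case: ifP.
- by rewrite invr_ge0 ler0n.
- by rewrite !big_ord_recl big_ord0 /=; field.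
- rewrite !big_ord_recl big_ord0 /= addr0 -scalerDr abc -mulr2n -scaler_nat scalerA.
  by rewrite mulVf ?scale1r // pnatr_eq0.
Qed.

Lemma sum_out e : edge_sum e + edge_out e = xv (src e) + xv (src e).
Proof. by rewrite /edge_sum /edge_out; apply/rowP => k; rewrite !mxE; ring. Qed.
Lemma sum_in e : edge_sum e + edge_in e = xv (tgt e) + xv (tgt e).
Proof. by rewrite /edge_sum /edge_in; apply/rowP => k; rewrite !mxE; ring. Qed.
Lemma out_in e : edge_out e + edge_in e = xe e + xe e.
Proof. by rewrite /edge_out /edge_in; apply/rowP => k; rewrite !mxE; ring. Qed.
Lemma sum_xe e : edge_sum e + xe e = xv (src e) + xv (tgt e).
Proof. by rewrite /edge_sum subrK. Qed.

(** Every x_v and x_e is the midpoint of two generators. For x_v this uses an edge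
    at v, which connectedness provides as soon as there is an edge. *)
Lemma polytope_points : graph_connected ends -> E ->
  cosmological_polytope R ends = conv [set` points].
Proof.
move=> [_ conn] e0.
have -> : cosmological_polytope R ends = conv [set` generators].
  congr conv; apply/seteqP; split=> a /=.
    move=> [e ae]; apply/generatorsP; exists e; rewrite !inE.
    by case: ae => ->; rewrite /edge_sum /edge_out /edge_in eqxx ?orbT.
  move=> /generatorsP[e]; rewrite !inE => /or3P[] /eqP ->; exists e.
  - exact: Or31.
  - exact: Or32.
  - exact: Or33.
apply/seteqP; split; apply: conv_subset => a.
  move=> /generatorsP[e ae]; apply/conv_fset_mem/pointsP; right; exists e.
  by rewrite inE ae orbT.
have gen e b : b \in [:: edge_sum e; edge_out e; edge_in e] -> b \in generators.
  by move=> be; apply/generatorsP; exists e.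
have gs e : edge_sum e \in generators by apply: (gen e); rewrite !inE eqxx.
have go e : edge_out e \in generators by apply: (gen e); rewrite !inE eqxx orbT.
have gi e : edge_in e \in generators by apply: (gen e); rewrite !inE eqxx !orbT.
have src_in e : conv [set` generators] (xv (src e)) :=
  conv_midpoint (gs e) (go e) (sum_out e).
have tgt_in e : conv [set` generators] (xv (tgt e)) :=
  conv_midpoint (gs e) (gi e) (sum_in e).
move=> /pointsP[[v ->]|[e]].
  have /connectP[[|u p] /= + uE] := conn v (src e0); first by rewrite -uE.
  move=> /andP[/existsP[e /orP[]/eqP ee] _].
    by rewrite (_ : v = src e) // ee.
  by rewrite (_ : v = tgt e) // ee.
rewrite inE => /orP[/eqP->|ae]; last exact/conv_fset_mem/(gen e).
exact: conv_midpoint (go e) (gi e) (out_in e).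
Qed.

(** Zero at the standard basis vectors and one at the generators, except at those
    equal to x_e because the edge is a loop. *)
Definition base_weight (a : 'rV[R]_n) : R := [exists k, a 0 k < 0]%:R.

Lemma base_weight_delta k : base_weight (delta_mx 0 k) = 0.
Proof.
rewrite /base_weight; case: existsP => // -[j].
by rewrite mxE ltrn0.
Qed.

Lemma base_weight_ge0 a : 0 <= base_weight a.
Proof. by rewrite /base_weight ler0n. Qed.

Lemma base_weight_sum e : base_weight (edge_sum e) = 1.
Proof.
rewrite /base_weight; case: existsP => // -[]; exists (rshift _ (enum_rank e)).
by rewrite !mxE !eqxx /= !eq_rlshift /= !addr0 sub0r oppr_lt0 ltr01.
Qed.

Lemma base_weight_out e : src e != tgt e -> base_weight (edge_out e) = 1.
Proof.
move=> ne; rewrite /base_weight; case: existsP => // -[].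
exists (lshift _ (enum_rank (tgt e))).
rewrite !mxE !eqxx /= eq_lrshift !eq_lshift (inj_eq enum_rank_inj) eq_sym (negbTE ne).
by rewrite addr0 sub0r oppr_lt0 ltr01.
Qed.

Section Heights.
Variable w : 'rV[R]_n -> R.
Hypothesis ww : forall a, a \in points -> `|w a - base_weight a| < 4^-1.
Variable u : 'cV[R]_n.
Hypothesis fu : feasible points w u.
Let s := tight points w u.

(** The weights of the left side exceed those of the right side by at least 1
    before the perturbation, which moves each of the four by less than 1/4; a
    functional attaining its bound at a and b would exceed it at a basis vector. *)
Lemma not_both_tight a b k l : base_weight a = 1 -> a \in s -> b \in s ->
  delta_mx 0 k \in points -> delta_mx 0 l \in points ->
  a + b = delta_mx 0 k + delta_mx 0 l -> False.
Proof.
set c := delta_mx 0 k; set d := delta_mx 0 l => a1 sa sb cA dA abcd.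
have aA := fsubsetP (tight_sub _ _ _) _ sa; have bA := fsubsetP (tight_sub _ _ _) _ sb.
have := congr1 (fun x => ev x u) abcd; rewrite !evDl (tight_ev sa) (tight_ev sb).
have := fu cA; have := fu dA; have := base_weight_ge0 b.
have := ww aA; have := ww bA; have := ww cA; have := ww dA.
rewrite a1 /c /d !base_weight_delta !ltr_norml.
move=> /andP[? ?] /andP[? ?] /andP[? ?] /andP[? ?]; lra.
Qed.

Lemma sum_xe_excl e : edge_sum e \in s -> xe e \in s -> False.
Proof.
move=> a b.
by apply: (not_both_tight (base_weight_sum e) a b _ _ (sum_xe e));
  exact: xv_point.
Qed.

Lemma sum_out_excl e : edge_sum e \in s -> edge_out e \in s -> False.
Proof.
move=> a b.
by apply: (not_both_tight (base_weight_sum e) a b _ _ (sum_out e));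
  exact: xv_point.
Qed.

Lemma sum_in_excl e : edge_sum e \in s -> edge_in e \in s -> False.
Proof.
move=> a b.
by apply: (not_both_tight (base_weight_sum e) a b _ _ (sum_in e));
  exact: xv_point.
Qed.

Lemma out_in_loop e : edge_out e \in s -> edge_in e \in s -> src e = tgt e.
Proof.
move=> a b; apply/eqP; apply: contrapT => /negP ne.
by apply: (not_both_tight (base_weight_out ne) a b _ _ (out_in e)); exact: xe_point.
Qed.

Lemma tight_pointsP (h : 'cV[R]_n) :
  (forall v, xv v \in s -> ev (xv v) h = 0) ->
  (forall e, xe e \in s -> ev (xe e) h = 0) ->
  (forall e, edge_sum e \in s -> ev (edge_sum e) h = 0) ->
  (forall e, edge_out e \in s -> ev (edge_out e) h = 0) ->
  (forall e, edge_in e \in s -> ev (edge_in e) h = 0) ->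
  forall a, a \in s -> ev a h = 0.
Proof.
move=> hv he hs ho hi a sa; have := fsubsetP (tight_sub _ _ _) _ sa.
move=> /pointsP[[v av]|[e]]; first by rewrite av hv // -av.
by rewrite !inE => /or4P[]/eqP ae; rewrite ae ?he ?hs ?ho ?hi // -ae.
Qed.

(** With hv the indicator of the vertices congruent to v0 modulo the integer
    span, he e is what the tight generators of e force: the exclusions make the
    requirements compatible, and the resulting functional vanishes on s. *)
Lemma intspan_xv v0 : spanning s -> intspan s (xv v0).
Proof.
move=> sp; apply: contrapT => nv0.
pose hv v : R := `[< intspan s (xv v - xv v0) >]%:R.
have hvE v w' : intspan s (xv v - xv w') -> hv v = hv w'.
  move=> vw; rewrite /hv; congr (nat_of_bool _)%:R; apply: asbool_equiv_eq; split=> H.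
    rewrite (_ : _ - _ = (xv v - xv v0) - (xv v - xv w')); first exact: intspanB.
    by rewrite opprB [RHS]addrC addrA subrK.
  rewrite (_ : _ - _ = (xv v - xv w') + (xv w' - xv v0)); first exact: intspanD.
  by rewrite addrA subrK.
pose he e : R := if edge_sum e \in s then hv (src e) + hv (tgt e)
  else if edge_out e \in s then hv (tgt e) - hv (src e)
  else if edge_in e \in s then hv (src e) - hv (tgt e) else 0.
have h0 : functional hv he = 0.
  apply: sp; apply: tight_pointsP => [v|e|e|e|e] sa.
  - rewrite ev_xv /hv; case: asboolP => // vN; case: nv0.
    rewrite (_ : xv v0 = xv v - (xv v - xv v0)); last by rewrite subKr.
    by apply: intspanB => //; exact: intspan_mem.
  - rewrite ev_xe /he; case: ifP => [/sum_xe_excl/(_ sa)//|_].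
    case: ifP => [so|_].
      rewrite (hvE (src e) (tgt e)) ?subrr //.
      rewrite (_ : _ - _ = edge_out e - xe e); last by rewrite /edge_out addrK.
      by apply: intspanB; exact: intspan_mem.
    case: ifP => [si|//].
    rewrite (hvE (tgt e) (src e)) ?subrr //.
    rewrite (_ : _ - _ = edge_in e - xe e); last by rewrite /edge_in addrK addrC.
    by apply: intspanB; exact: intspan_mem.
  - by rewrite /edge_sum evBl evDl !ev_xv ev_xe /he sa subrr.
  - rewrite /edge_out evDl evBl !ev_xv ev_xe /he; case: ifP => [/sum_out_excl/(_ sa)//|_].
    by rewrite sa; ring.
  - rewrite /edge_in !evDl evNl !ev_xv ev_xe /he; case: ifP => [/sum_in_excl/(_ sa)//|_].
    case: ifP => [/out_in_loop/(_ sa)->|_]; first by ring.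
    by rewrite sa; ring.
have := ev_xv v0 hv he; rewrite h0 ev0r /hv; case: asboolP => [_ /eqP|[]].
  by rewrite eq_sym oner_eq0.
by rewrite subrr; exact: intspan0.
Qed.

(** Some tight point involves e, as otherwise the coordinate of e would vanish on
    s. It is x_e up to sign and an integer combination of the x_v. *)
Lemma intspan_xe e : spanning s -> intspan s (xe e).
Proof.
move=> sp; have iv v := intspan_xv v sp; apply: contrapT => ne.
pose he e' : R := (e' == e)%:R.
have h0 : functional (fun=> 0) he = 0.
  have heE e' : (e' = e -> False) -> he e' = 0 by move=> ee; rewrite /he; case: eqP.
  apply: sp; apply: tight_pointsP => [v|e'|e'|e'|e'] sa.
  - exact: ev_xv.
  - by rewrite ev_xe heE // => ee; apply: ne; rewrite -ee; exact: intspan_mem.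
  - rewrite /edge_sum evBl evDl !ev_xv ev_xe heE ?addr0 ?subrr // => ee; apply: ne.
    rewrite -ee (_ : xe e' = xv (src e') + xv (tgt e') - edge_sum e').
      by apply: intspanB; [exact: intspanD | exact: intspan_mem].
    by rewrite /edge_sum subKr.
  - rewrite /edge_out evDl evBl !ev_xv ev_xe heE ?addr0 ?subrr // => ee; apply: ne.
    rewrite -ee (_ : xe e' = edge_out e' - (xv (src e') - xv (tgt e'))).
      by apply: intspanB; [exact: intspan_mem | exact: intspanB].
    by rewrite /edge_out addrC addKr.
  - rewrite /edge_in !evDl evNl !ev_xv ev_xe heE ?addr0 ?oppr0 // => ee; apply: ne.
    rewrite -ee (_ : xe e' = edge_in e' - (xv (tgt e') - xv (src e'))).
      by apply: intspanB; [exact: intspan_mem | exact: intspanB].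
    by rewrite /edge_in; apply/rowP => k; rewrite !mxE; ring.
have := ev_xe e (fun=> 0) he; rewrite h0 ev0r /he eqxx => /eqP.
by rewrite eq_sym oner_eq0.
Qed.

Lemma spanning_tight_int x : spanning s -> int_points R n x -> intspan s x.
Proof.
move=> sp; apply: intspan_int; apply: (coord_ind (Q := intspan s)) => [v|e].
  exact: intspan_xv.
exact: intspan_xe.
Qed.

End Heights.

(** Convex combinations of no points do not exist, as coefficients sum to 1. *)
Lemma edgeless_polytope : (E -> False) -> cosmological_polytope R ends = set0.
Proof.
move=> noE; apply/seteqP; split=> // x [m [p [c [pP _ c1 _]]]].
case: m p c pP c1 => [|m] p c pP c1; last by have [e _] := pP ord0; case: (noE e).
by move: c1 => /eqP; rewrite big_ord0 eq_sym oner_eq0.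
Qed.

Lemma empty_triangulation k :
  let T : {fset {fset 'rV[R]_k}} := fset0 in
  lattice_triangulation set0 T /\ regular set0 T /\ unimodular set0 T.
Proof.
split; [|split].
- split=> //; apply/seteqP; split=> // x [s]; by rewrite /= inE.
- exists (fun=> 0); apply/seteqP; split=> C; first by move=> [s]; rewrite /= inE.
  move=> [F [[y Fy] [U [_ FE]]] _]; move: Fy; rewrite FE => -[[m [p [c [pP _ c1 _]]]] _].
  case: m p c pP c1 => [|m] p c pP c1; last by have [q [[]]] := pP ord0.
  by move: c1 => /eqP; rewrite big_ord0 eq_sym oner_eq0.
- by move=> s; rewrite inE.
Qed.

End CosmologicalPolytope.

Theorem theorem1 (R : realType) (V E : finType) (ends : E -> V * V)
    (Gconn : graph_connected ends) :
  exists T : {fset {fset 'rV[R]_(#|V| + #|E|)}},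
    lattice_triangulation (cosmological_polytope R ends) T /\
    regular (cosmological_polytope R ends) T /\
    unimodular (cosmological_polytope R ends) T.
Proof.
have [[e0]|noE] := pselect (inhabited E); last first.
  exists fset0; rewrite edgeless_polytope => [|e]; last by apply: noE.
  exact: empty_triangulation.
rewrite (polytope_points R Gconn e0).
set A := points R ends.
have sgA := @points_coord_sum R V E ends.
have intA := @points_int R V E ends.
have spA := @points_spanning R V E ends.
have b0 : 0 < 4^-1 :> R by rewrite invr_gt0 ltr0n.
have [w ww genw] := generic_weight A (@base_weight R V E) b0.
exists (cells A w); split; first exact: cells_triangulation sgA spA genw intA.
split; first exact: cells_regular sgA intA.
move=> s sT smax; have sps := maximal_cell_spanning spA sT smax.
have ind := cell_independent genw sT.
have [s0 [u fu us]] := (cellsP _ _ _).1 sT.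
apply: unimodular_simplex sgA intA s0 _ ind _; first by rewrite -us tight_sub.
by move=> x ix; rewrite -us; apply: (spanning_tight_int ww fu) => //; rewrite us.
Qed.
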